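(* Let $\mathrm{val}(P)$ and $\mathrm{val}(\tilde P)$ denote the optimal values of the problems $$(P)\quad \inf_{(m,\pi)}\ \mathcal J(m,\pi)\quad\text{subject to } \pi\in\Delta,\ m=m^{\pi},$$ $$(\tilde P)\quad \inf_{(m,w)\in\mathcal R}\ \tilde{\mathcal J}(m,w)\quad\text{subject to } \mathbf S w-m+\bar m_0=0 .$$ Then $\mathrm{val}(P)=\mathrm{val}(\tilde P)$. In addition, if Problem $(P)$ is feasible (i.e. there is $\pi\in\Delta$ with $\mathcal J(m^\pi,\pi)<+\infty$), then both problems $(P)$ and $(\tilde P)$ have a non-empty bounded set of solutions.
   Context: Let $T\ge 1$, $n\ge 1$ be integers, $\mathcal T=\{0,\dots,T-1\}$, $\bar{\mathcal T}=\{0,\dots,T\}$, $S=\{0,\dots,n-1\}$. For a finite set $A$, $\mathbb R(A)$ is the space of functions $A\to\mathbb R$. Let $\Delta(S)=\{\rho:S\to[0,1]:\sum_{x}\rho(x)=1\}$ and $\Delta=\{\pi:\mathcal T\times S\times S\to[0,1]:\pi(t,x,\cdot)\in\Delta(S)\ \forall (t,x)\}$. Let $\mathcal R=\mathbb R(\bar{\mathcal T}\times S)\times\mathbb R(\mathcal T\times S^2)$. Data: $m_0\in\Delta(S)$, $\alpha:\mathcal T\times S^2\to\mathbb R$, $\ell:\mathcal T\times S\times\mathbb R(S)\to\mathbb R\cup\{+\infty\}$, $\phi:\mathcal T\times\mathbb R\to\mathbb R\cup\{+\infty\}$, $F:\bar{\mathcal T}\times\mathbb R(S)\to\mathbb R\cup\{+\infty\}$.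 Standing assumption: for all $(t,s,x)\in\mathcal T\times\bar{\mathcal T}\times S$ the functions $\ell(t,x,\cdot)$, $F(s,\cdot)$, $\phi(t,\cdot)$ are proper, convex and lower semicontinuous, and $\mathrm{dom}(\ell(t,x,\cdot))\subseteq\Delta(S)$. For $\pi\in\Delta$, $m^\pi\in\mathbb R(\bar{\mathcal T}\times S)$ is the solution of the Kolmogorov equation $m(0,x)=m_0(x)$, $m(t+1,x)=\sum_{y\in S}m(t,y)\pi(t,y,x)$ for $t\in\mathcal T$. Criterion of $(P)$: $$\mathcal J(m,\pi)=\sum_{(t,x)\in\mathcal T\times S}m(t,x)\,\ell(t,x,\pi(t,x,\cdot))+\sum_{t\in\mathcal T}\phi\Big(t,\sum_{(x,y)\in S^2}m(t,x)\pi(t,x,y)\alpha(t,x,y)\Big)+\sum_{s\in\bar{\mathcal T}}F(s,m(s,\cdot)),$$ with the convention $0\cdot(+\infty)=0$. Operators: $\mathbf A[w](t)=\sum_{(x,y)\in S^2}w(t,x,y)\alpha(t,x,y)$; $\mathbf S[w](s,x)=\sum_{y\in S}w(s-1,y,x)$ if $s>0$, and $\mathbf S[w](0,x)=0$. The function $\bar m_0\in\mathbb R(\bar{\mathcal T}\times S)$ is $\bar m_0(0,x)=m_0(x)$ and $\bar m_0(s,x)=0$ for $s>0$. Perspective: for $\theta\in\mathbb R$, $z\in\mathbb R(S)$, $\tilde\ell(t,x,\theta,z)=\theta\,\ell(t,x,z/\theta)$ if $\theta>0$; $=0$ if $(\theta,z)=(0,0)$; $=+\infty$ otherwise. Criterion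 of $(\tilde P)$: $$\tilde{\mathcal J}(m,w)=\sum_{(t,x)\in\mathcal T\times S}\tilde\ell(t,x,m(t,x),w(t,x,\cdot))+\sum_{t\in\mathcal T}\phi(t,\mathbf A[w](t))+\sum_{s\in\bar{\mathcal T}}F(s,m(s,\cdot)).$$ *)

(* Defs.v *)
From HB Require Import structures.
From mathcomp Require Import all_boot all_order all_algebra.
From mathcomp Require Import all_classical all_reals all_analysis.

Set Implicit Arguments.
Unset Strict Implicit.
Unset Printing Implicit Defensive.

Import Order.TTheory GRing.Theory Num.Theory.
Import numFieldNormedType.Exports.

Local Open Scope classical_set_scope.
Local Open Scope ring_scope.

(* Encodings. The set S is 'I_n, the time sets {0,...,T-1} and {0,...,T} are
   'I_T and 'I_T.+1. Functions on S are row vectors, functions on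
   {0,...,T} x S are matrices (row s of m is m(s,.)), and functions on
   {0,...,T-1} x S x S are families of matrices (w(t,x,y) is w t x y, and
   w(t,x,.) is row x (w t)). Functions with values in the reals extended by
   +oo are \bar R-valued functions that avoid -oo; this is part of [eproper]. *)

Definition eproper (R : realType) (X : Type) (f : X -> \bar R) : Prop :=
  (forall x, f x != -oo%E) /\ (exists x, f x != +oo%E).

(* At k = 0 and k = 1 the inequality is trivial, since 0 * +oo = 0 in \bar R. *)
Definition econvex (R : realType) (V : lmodType R) (f : V -> \bar R) : Prop :=
  forall (x y : V) (k : R), 0 <= k <= 1 ->
    (f (k *: x + (1 - k) *: y)%R <= k%:E * f x + (1 - k)%:E * f y)%E.

Definition proper_convex_lsc (R : realType) (V : normedModType R)
    (f : V -> \bar R) : Prop :=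
  [/\ eproper f, econvex f & lower_semicontinuous f].

Definition optval (R : realType) (X : Type) (C : set X) (f : X -> \bar R) :
    \bar R :=
  ereal_inf (f @` C).

Definition solutions (R : realType) (X : Type) (C : set X) (f : X -> \bar R) :
    set X :=
  [set p | C p /\ f p = optval C f].

Definition simplex (R : realType) (n : nat) : set 'rV[R]_n :=
  [set rho | (forall x, 0 <= rho 0 x <= 1) /\ \sum_(x < n) rho 0 x = 1].

Arguments simplex : clear implicits.

Definition policies (R : realType) (T n : nat) : set ('I_T -> 'M[R]_n) :=
  [set pi | forall t x, simplex R n (row x (pi t))].

Arguments policies : clear implicits.

(* The product of the spaces of functions on {0,...,T} x S and on
   {0,...,T-1} x S x S. *)
Definition pairs (R : realType) (T n : nat) : Type :=
  ('M[R]_(T.+1, n) * ('I_T -> 'M[R]_n))%type.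

(* Boundedness for the sup norm; the norm of a matrix is its sup norm. *)
Definition bounded_pairs (R : realType) (T n : nat) (A : set (pairs R T n)) :
    Prop :=
  exists M : R, forall p, A p -> `|p.1| <= M /\ forall t, `|p.2 t| <= M.

(* The times t and t + 1, for t in {0,...,T-1}, as elements of {0,...,T}. *)
Definition cur_time (T : nat) (t : 'I_T) : 'I_T.+1 := widen_ord (leqnSn T) t.
Definition next_time (T : nat) (t : 'I_T) : 'I_T.+1 := lift ord0 t.

Definition kolmogorov (R : realType) (T n : nat) (m0 : 'rV[R]_n)
    (pi : 'I_T -> 'M[R]_n) (m : 'M[R]_(T.+1, n)) : Prop :=
  (forall x, m ord0 x = m0 0 x) /\
  (forall (t : 'I_T) x,
     m (next_time t) x = \sum_(y < n) m (cur_time t) y * pi t y x).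

(* The value 0 is never used by [flow] at times k <= T. *)
Definition policy_at (R : realType) (T n : nat) (pi : 'I_T -> 'M[R]_n)
    (k : nat) : 'M[R]_n :=
  if insub k is Some t then pi t else 0.

Fixpoint flow (R : realType) (T n : nat) (m0 : 'rV[R]_n)
    (pi : 'I_T -> 'M[R]_n) (k : nat) : 'rV[R]_n :=
  if k is k'.+1 then flow m0 pi k' *m policy_at pi k' else m0.

Definition kolmogorov_sol (R : realType) (T n : nat) (m0 : 'rV[R]_n)
    (pi : 'I_T -> 'M[R]_n) : 'M[R]_(T.+1, n) :=
  \matrix_(s, x) flow m0 pi s 0 x.

Lemma kolmogorov_solP (R : realType) (T n : nat) (m0 : 'rV[R]_n)
    (pi : 'I_T -> 'M[R]_n) (m : 'M[R]_(T.+1, n)) :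
  kolmogorov m0 pi m <-> m = kolmogorov_sol m0 pi.
Proof.
have flowS (t : 'I_T) x : flow m0 pi t.+1 0 x =
    \sum_(y < n) flow m0 pi t 0 y * pi t y x.
  by rewrite /= /policy_at valK mxE.
split=> [[m_0 mS]|->]; last first.
  split=> [x|t x]; first by rewrite mxE.
  by rewrite mxE flowS; apply: eq_bigr => y _; rewrite mxE.
apply/matrixP => -[k kT] x; rewrite mxE /=.
elim: k kT x => [|k IH] kT x.
  by rewrite -m_0; congr (m _ x); apply: val_inj.
have -> : Ordinal kT = next_time (Ordinal (kT : k < T)%N) by apply: val_inj.
rewrite mS (flowS (Ordinal (kT : k < T)%N)); apply: eq_bigr => y _.
by rewrite -(IH (ltnW kT)); congr (m _ y * _); apply: val_inj.
Qed.

(* If m(t,x) = 0 and ell = +oo, the product is 0: 0 * +oo = 0 in \bar R. *)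
Definition crit (R : realType) (T n : nat) (alpha : 'I_T -> 'M[R]_n)
    (ell : 'I_T -> 'I_n -> 'rV[R]_n -> \bar R) (phi : 'I_T -> R -> \bar R)
    (F : 'I_T.+1 -> 'rV[R]_n -> \bar R) (p : pairs R T n) : \bar R :=
  let: (m, pi) := p in
  (\sum_(t < T) \sum_(x < n) (m (cur_time t) x)%:E * ell t x (row x (pi t))
   + \sum_(t < T)
       phi t (\sum_(x < n) \sum_(y < n)
                m (cur_time t) x * pi t x y * alpha t x y)%R
   + \sum_(s < T.+1) F s (row s m))%E.

Definition feasP (R : realType) (T n : nat) (m0 : 'rV[R]_n) :
    set (pairs R T n) :=
  [set p | policies R T n p.2 /\ p.1 = kolmogorov_sol m0 p.2].

Definition opA (R : realType) (T n : nat) (alpha w : 'I_T -> 'M[R]_n)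
    (t : 'I_T) : R :=
  \sum_(x < n) \sum_(y < n) w t x y * alpha t x y.

(* unlift ord0 s is Some (s - 1) if s > 0, and None if s = 0. *)
Definition opS (R : realType) (T n : nat) (w : 'I_T -> 'M[R]_n) :
    'M[R]_(T.+1, n) :=
  \matrix_(s, x)
    if unlift ord0 s is Some t then \sum_(y < n) w t y x else 0.

Definition mbar0 (R : realType) (T n : nat) (m0 : 'rV[R]_n) :
    'M[R]_(T.+1, n) :=
  \matrix_(s, x) if s == ord0 then m0 0 x else 0.

Definition perspective (R : realType) (n : nat) (f : 'rV[R]_n -> \bar R)
    (theta : R) (z : 'rV[R]_n) : \bar R :=
  if 0 < theta then (theta%:E * f (theta^-1 *: z)%R)%E
  else if (theta == 0) && (z == 0) then 0%E
  else +oo%E.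

Definition crit_tilde (R : realType) (T n : nat) (alpha : 'I_T -> 'M[R]_n)
    (ell : 'I_T -> 'I_n -> 'rV[R]_n -> \bar R) (phi : 'I_T -> R -> \bar R)
    (F : 'I_T.+1 -> 'rV[R]_n -> \bar R) (p : pairs R T n) : \bar R :=
  let: (m, w) := p in
  (\sum_(t < T) \sum_(x < n)
       perspective (ell t x) (m (cur_time t) x) (row x (w t))
   + \sum_(t < T) phi t (opA alpha w t)
   + \sum_(s < T.+1) F s (row s m))%E.

Definition feasP_tilde (R : realType) (T n : nat) (m0 : 'rV[R]_n) :
    set (pairs R T n) :=
  [set p | opS p.2 - p.1 + mbar0 T m0 = 0].

(* Main.v *)
Require Import Defs.
From mathcomp Require Import all_boot all_order all_algebra.
From mathcomp Require Import all_classical all_reals all_analysis.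
Import Order.TTheory GRing.Theory Num.Theory.
Import numFieldNormedType.Exports.
Local Open Scope classical_set_scope.
Local Open Scope ring_scope.

Set Implicit Arguments.
Unset Strict Implicit.
Unset Printing Implicit Defensive.

(** Multiplying a policy by the mass it acts on turns a feasible pair [(m, pi)]
    of the nonconvex problem into a feasible pair [(m, w)], [w = m * pi], of
    the relaxed one, at equal cost ([crit_flux]): where [m(t,x) > 0] the
    perspective recovers [pi = w / m], and where [m(t,x) = 0] both terms
    vanish, the latter because of the convention [0 * oo = 0]. Conversely, a
    relaxed pair of finite cost has finite perspectives, so [w(t,x,.)] is
    [m(t,x)] times a point of the domain of [ell(t,x,.)], hence of the simplex,
    or [m(t,x)] and [w(t,x,.)] both vanish; either way [w] comes from a policy
    ([feasP_tilde_lty]). The two problems therefore have the same value, and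
    minimizers of one yield minimizers of the other.

    A minimizer is obtained on the side of the policies, by the direct method.
    Policies form a product of simplices, which is compact, and the criterion
    is lower semicontinuous along it ([crit_liminf]). The one delicate summand
    is [m(t,x) * ell(t,x,pi(t,x,.))] near a point with [m(t,x) = 0], where
    [ell] may be [+oo]: since [ell(t,x,.)] is bounded below on the simplex,
    the lower limit of the product is still nonnegative ([liminf_geM]).

    Boundedness holds because masses, policies and fluxes of feasible pairs
    have entries in [0,1]; the solutions of the relaxed problem are such
    fluxes as soon as the common value is finite. *)

(** * Lower limits along a filter *)

(** The inequality [l <= liminf_G f], phrased like [lower_semicontinuous] but
    along an arbitrary filter, so that it can be restricted to a subset with
    [within]. *)
Definition liminf_ge (R : realType) (X : Type) (G : set_system X)
    (f : X -> \bar R) (l : \bar R) : Prop :=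
  forall a : R, (a%:E < l)%E -> \forall x \near G, (a%:E < f x)%E.

Lemma ereal_real_between (R : realType) (x y : \bar R) :
  (x < y)%E -> exists2 a : R, (x < a%:E)%E & (a%:E < y)%E.
Proof.
case: x y => [x| |] [y| |] //=; rewrite ?lte_fin => xy.
- by exists ((x + y) / 2); rewrite lte_fin ?midf_lt.
- by exists (x + 1); rewrite ?ltry // lte_fin ltrDl.
- by exists (y - 1); rewrite ?ltNyr // lte_fin ltrBlDr ltrDl.
- by exists 0; rewrite ?ltNyr ?ltry.
Qed.

Lemma lt_adde_split (R : realType) (a : R) (x y : \bar R) :
  (a%:E < x + y)%E ->
  exists b c : R, [/\ (b%:E < x)%E, (c%:E < y)%E & a = b + c].
Proof.
case: x y => [x| |] [y| |] //=.
(* Each summand gives up half of the slack [x + y - a]. *)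
- rewrite -EFinD lte_fin => axy.
  exists (x - (x + y - a) / 2), (y - (x + y - a) / 2).
  rewrite !lte_fin !ltrBlDr !ltrDl; split; try by rewrite divr_gt0 // subr_gt0.
  by rewrite addrACA -opprD -splitr opprB addrC subrK.
- exists (x - 1), (a - (x - 1)); rewrite !ltry lte_fin ltrBlDr ltrDl.
  by split=> //; rewrite addrC subrK.
- exists (a - (y - 1)), (y - 1); rewrite !ltry lte_fin ltrBlDr ltrDl.
  by split=> //; rewrite subrK.
- by exists 0, a; rewrite !ltry add0r.
Qed.

Section liminf_ge.
Variables (R : realType) (X : Type) (G : set_system X).
Context {FG : Filter G}.

(** This covers limits [+oo] and [-oo] too: their sum is [-oo], and no real lies
    below it. *)
Lemma liminf_geD (f g : X -> \bar R) l k :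
  liminf_ge G f l -> liminf_ge G g k ->
  liminf_ge G (fun x => f x + g x)%E (l + k)%E.
Proof.
move=> fl gk a /lt_adde_split[b [c [bl ck ->]]].
by near=> x; rewrite EFinD; apply: lteD; near: x; [exact: fl|exact: gk].
Unshelve. all: by end_near. Qed.

Lemma liminf_ge_sum (I : Type) (r : seq I) (f : I -> X -> \bar R)
    (l : I -> \bar R) :
  (forall i, liminf_ge G (f i) (l i)) ->
  liminf_ge G (fun x => \sum_(i <- r) f i x)%E (\sum_(i <- r) l i)%E.
Proof.
move=> fl; elim: r => [|i r IH].
  by move=> a; rewrite big_nil => a0; apply: nearW => x; rewrite big_nil.
under [X in liminf_ge _ X]eq_fun do rewrite big_cons.
by rewrite big_cons; apply: liminf_geD.
Qed.

Lemma liminf_ge_comp (Y : topologicalType) (h : Y -> \bar R) (u : X -> Y)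
    (p : Y) :
  lower_semicontinuous h -> u @ G --> p -> liminf_ge G (h \o u) (h p).
Proof.
move=> lsch up a /lsch[V pV Va].
by apply: (@filterS _ G _ (u @^-1` V)); [move=> x; exact: Va|exact: up].
Qed.

(** When [u0 = 0] the limit [u0 * l] is [0] whatever [l] is, and only the lower
    bound [c] on [f] prevents [u * f] from dropping below it. In both cases
    the proof compares [u * f] with [u * b] for a real [b] that is eventually
    below [f] and satisfies [a < u0 * b]. *)
Lemma liminf_geM (u : X -> R) (f : X -> \bar R) (u0 : R) (l : \bar R) (c : R) :
  u @ G --> u0 -> 0 <= u0 -> (\forall x \near G, 0 <= u x) ->
  (\forall x \near G, c%:E <= f x)%E -> liminf_ge G f l ->
  liminf_ge G (fun x => (u x)%:E * f x)%E (u0%:E * l)%E.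
Proof.
move=> uu0 u00 uge0 cf fl a al.
have [b ab bf] : exists2 b : R, a < u0 * b & \forall x \near G, (b%:E <= f x)%E.
  move: u00; rewrite le_eqVlt => /predU1P[u00|u00].
    by exists c => //; move: al; rewrite -u00 mul0e mul0r.
  have : ((a / u0)%:E < l)%E.
    move: al; case: (l) => [l'| |] //=; rewrite ?ltry //.
      by rewrite -EFinM !lte_fin ltr_pdivrMr// mulrC.
    by rewrite gt0_muleNy// lte_fin.
  move=> /ereal_real_between[b ab bl].
  exists b; first by move: ab; rewrite lte_fin ltr_pdivrMr// mulrC.
  by near=> x; apply/ltW; near: x; exact: fl.
have : u x * b @[x --> G] --> u0 * b by apply: cvgM => //; exact: cvg_cst.
move=> /cvgr_gt/(_ _ ab) ub; near=> x.
apply: (@lt_le_trans _ _ (u x * b)%:E); first by rewrite lte_fin; near: x.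
rewrite EFinM; apply: lee_wpmul2l; first by rewrite lee_fin; near: x.
by near: x.
Unshelve. all: by end_near. Qed.
End liminf_ge.

(** Weierstrass' theorem. If no point of [K] is a minimizer, every [x] in [K]
    has a [y] in [K] with [f y < f x], and lower semicontinuity spreads this to a
    neighbourhood of [x], uniformly over the points below [y]. Compactness then
    gives one [y] in [K] with [f y < f x] for all [x] in [K], which fails at
    [x = y]. *)
Lemma lsc_compact_min (R : realType) (X : topologicalType) (K : set X)
    (f : X -> \bar R) :
  compact K -> K !=set0 ->
  (forall x, K x -> liminf_ge (within K (nbhs x)) f (f x)) ->
  exists2 x, K x & forall y, K y -> (f x <= f y)%E.
Proof.
move=> /compact_near_coveringP cK [x0 Kx0] lscf; apply: contrapT => nomin.
have below x : K x -> exists2 y, K y & (f y < f x)%E.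
  move=> Kx; apply: contrapT => nobelow; apply: nomin; exists x => // y Ky.
  by rewrite leNgt; apply/negP => yx; apply: nobelow; exists y.
(* The filter of the sublevel sets of [f] at points of [K]: converging along it
   means going down to the infimum of [f] on [K]. *)
pose G : set_system X :=
  [set A | exists2 y, K y & [set z | (f z <= f y)%E] `<=` A].
have FG : Filter G.
  split.
  - by exists x0.
  - move=> A B [y Ky yA] [z Kz zB]; have [yz|zy] := leP (f y) (f z).
      exists y => // w /= wy; split; first exact: yA.
      by apply: zB; exact: le_trans yz.
    exists z => // w /= wz; split; last exact: zB.
    by apply: yA; apply: le_trans (ltW zy).
  - by move=> A B AB [y Ky yA]; exists y => //; exact: subset_trans AB.
have nearP : forall x, K x ->
    \forall z \near x & v \near G, K z -> (f v < f z)%E.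
  move=> x Kx; have [y Ky yx] := below x Kx.
  have [a ya ax] := ereal_real_between yx.
  have := lscf x Kx a ax; rewrite /within /= => xa.
  exists ([set z | K z -> (a%:E < f z)%E], [set z | (f z <= f y)%E]).
    by split => //; exists y.
  move=> [u v] /= [ua vy] Ku; apply: le_lt_trans (ua Ku).
  exact: le_trans vy (ltW ya).
have [y Ky yP] := cK _ G (fun v x => K x -> (f v < f x)%E) FG nearP.
by have := yP y (lexx _) y Ky Ky; rewrite ltxx.
Qed.

(** * The flux correspondence *)

Lemma simplexP (R : realType) (n : nat) (rho : 'rV[R]_n) :
  simplex R n rho <-> (forall x, 0 <= rho 0 x) /\ \sum_(x < n) rho 0 x = 1.
Proof.
split=> [[b s1]|[ge0 s1]]; split=> // x; first by have /andP[] := b x.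
by rewrite ge0 -s1 (bigD1 x)//= lerDl sumr_ge0.
Qed.

Lemma flow_simplex (R : realType) (T n : nat) (m0 : 'rV[R]_n)
    (pi : 'I_T -> 'M[R]_n) (k : nat) :
  simplex R n m0 -> policies R T n pi -> (k <= T)%N ->
  simplex R n (flow m0 pi k).
Proof.
move=> sm0 spi; elim: k => // k IH kT.
have /simplexP[m_ge0 m_sum] := IH (ltnW kT).
apply/simplexP; rewrite /= /policy_at insubT.
have pi_ge0 x y : 0 <= pi (Ordinal kT) x y.
  by have /simplexP[/(_ y)] := spi (Ordinal kT) x; rewrite mxE.
split=> [x|]; first by rewrite mxE sumr_ge0// => y _; rewrite mulr_ge0.
under eq_bigr do rewrite mxE.
rewrite exchange_big /= -[RHS]m_sum; apply: eq_bigr => y _.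
rewrite -mulr_sumr; have /simplexP[_] := spi (Ordinal kT) y.
by under eq_bigr do rewrite mxE; move=> ->; rewrite mulr1.
Qed.

Lemma esum_neNy (R : realType) (I : eqType) (r : seq I) (f : I -> \bar R) :
  (forall i, f i != -oo%E) -> (\sum_(i <- r) f i)%E != -oo%E.
Proof.
move=> fN; apply/eqP => /esum_eqNyP[i [_ _ fi]].
by move: (fN i); rewrite fi eqxx.
Qed.

Section flux.
Variables (R : realType) (T n : nat) (m0 : 'rV[R]_n).
Hypothesis sm0 : simplex R n m0.
Variables (alpha : 'I_T -> 'M[R]_n) (ell : 'I_T -> 'I_n -> 'rV[R]_n -> \bar R)
  (phi : 'I_T -> R -> \bar R) (F : 'I_T.+1 -> 'rV[R]_n -> \bar R).

Definition flux (p : pairs R T n) : pairs R T n :=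
  (p.1, fun t => \matrix_(x, y) (p.1 (cur_time t) x * p.2 t x y)).

Lemma feasP_mass (p : pairs R T n) (s : 'I_T.+1) :
  feasP m0 p -> simplex R n (row s p.1).
Proof.
move=> [pol ->]; have := flow_simplex sm0 pol (leq_ord s).
by congr (simplex R n _); apply/rowP => x; rewrite !mxE.
Qed.

Lemma feasP_mass_ge0 (p : pairs R T n) s x : feasP m0 p -> 0 <= p.1 s x.
Proof. by move=> /(feasP_mass s)/simplexP[/(_ x)]; rewrite mxE. Qed.

(** At a positive mass the scaling by [m(t,x)] cancels in the perspective, and at
    zero mass both terms are [0]. *)
Lemma crit_flux (p : pairs R T n) : (forall s x, 0 <= p.1 s x) ->
  crit_tilde alpha ell phi F (flux p) = crit alpha ell phi F p.
Proof.
case: p => m pi m_ge0; rewrite /crit_tilde /crit /=.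
congr (_ + _ + _)%E.
  apply: eq_bigr => t _; apply: eq_bigr => x _.
  have -> : row x (\matrix_(x0, y) (m (cur_time t) x0 * pi t x0 y)) =
      m (cur_time t) x *: row x (pi t) by apply/rowP => y; rewrite !mxE.
  have := m_ge0 (cur_time t) x; rewrite /= le_eqVlt => /predU1P[<-|m_gt0].
    by rewrite /perspective ltxx scale0r !eqxx mul0e.
  by rewrite /perspective m_gt0 scalerA mulVf ?gt_eqF// scale1r.
apply: eq_bigr => t _; congr (phi t _).
by apply: eq_bigr => x _; apply: eq_bigr => y _; rewrite mxE.
Qed.

Lemma feasP_tildeE (m : 'M[R]_(T.+1, n)) (w : 'I_T -> 'M[R]_n) :
  feasP_tilde m0 (m, w) <->
  (forall x, m ord0 x = m0 0 x) /\
  (forall t x, m (next_time t) x = \sum_(y < n) w t y x).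
Proof.
split=> [/= /matrixP eq0|[m_0 mS]].
  split=> [x|t x].
    have := eq0 ord0 x; rewrite !mxE unlift_none eqxx sub0r addrC.
    by move/subr0_eq.
  have := eq0 (next_time t) x; rewrite !mxE /next_time liftK eq_sym.
  by rewrite (negbTE (neq_lift _ _)) addr0 => /subr0_eq.
apply/matrixP => s x; rewrite !mxE.
have [t|] := unliftP ord0 s => ->.
  rewrite -[lift ord0 t]/(next_time t) mS /next_time eq_sym.
  by rewrite (negbTE (neq_lift _ _)) addr0 subrr.
by rewrite eqxx m_0 sub0r addNr.
Qed.

Lemma feasP_flux (p : pairs R T n) : feasP m0 p -> feasP_tilde m0 (flux p).
Proof.
case: p => m pi [_ /= /kolmogorov_solP[m_0 mS]].
apply/feasP_tildeE; split=> // t x.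
by rewrite mS; apply: eq_bigr => y _; rewrite mxE.
Qed.

Hypothesis ellN : forall t x z, ell t x z != -oo%E.
Hypothesis phiN : forall t a, phi t a != -oo%E.
Hypothesis FN : forall s z, F s z != -oo%E.
Hypothesis hdom : forall t x z, (ell t x z < +oo)%E -> simplex R n z.

Lemma perspective_neNy (f : 'rV[R]_n -> \bar R) (theta : R) z :
  (forall z, f z != -oo%E) -> perspective f theta z != -oo%E.
Proof.
move=> fN; rewrite /perspective; case: ifPn => [th|_]; last by case: ifP.
by move: (fN (theta^-1 *: z)); case: (f _) => // _; rewrite gt0_muley.
Qed.

(** A sum of extended reals none of which is [-oo] is [+oo] as soon as one term
    is, so finite cost passes to each perspective. *)
Lemma crit_tilde_lty (q : pairs R T n) t x :
  (crit_tilde alpha ell phi F q < +oo)%E ->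
  (perspective (ell t x) (q.1 (cur_time t) x) (row x (q.2 t)) < +oo)%E.
Proof.
case: q => m w; rewrite /crit_tilde /= ltNge leye_eq => fin.
rewrite ltNge leye_eq; apply: contra fin => /eqP pty.
pose P t x := perspective (ell t x) (m (cur_time t) x) (row x (w t)).
have PN t' x' : P t' x' != -oo%E by exact: perspective_neNy.
rewrite [X in (X + _ + _)%E](_ : _ = +oo%E).
  by rewrite !addye //; apply: esum_neNy => i.
apply/esum_eqyP => [t' _|]; first by apply: esum_neNy => x'; exact: PN.
exists t; split; rewrite ?mem_index_enum//.
apply/esum_eqyP => [x' _|]; first exact: PN.
by exists x; split; rewrite ?mem_index_enum.
Qed.

(** At [theta = 0] the direction [rho] is arbitrary, and the initial
    distribution [m0] provides a point of the simplex. *)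
Lemma perspective_lty (f : 'rV[R]_n -> \bar R) theta z :
  (forall z, (f z < +oo)%E -> simplex R n z) ->
  (perspective f theta z < +oo)%E ->
  exists2 rho, simplex R n rho & z = theta *: rho.
Proof.
move=> fdom; rewrite /perspective; case: ifPn => [th_gt0 fin|_].
  exists (theta^-1 *: z); last first.
    by rewrite scalerA divff ?gt_eqF// scale1r.
  apply: fdom; rewrite ltNge leye_eq; apply/eqP => fy.
  by move: fin; rewrite fy gt0_muley ?lte_fin.
case: ifPn => [/andP[/eqP -> /eqP ->] _|//].
by exists m0 => //; rewrite scale0r.
Qed.

(** Finite cost forces each [w(t,x,.)] into the cone over the simplex at height
    [m(t,x)], so a policy can be divided out; the linear constraint then is the
    Kolmogorov equation of that policy. *)
Lemma feasP_tilde_lty (q : pairs R T n) :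
  feasP_tilde m0 q -> (crit_tilde alpha ell phi F q < +oo)%E ->
  exists2 p, feasP m0 p & flux p = q.
Proof.
case: q => m w /feasP_tildeE[m_0 mS] fin.
have kernel t x :
    {rho | simplex R n rho & row x (w t) = m (cur_time t) x *: rho}.
  apply: cid2; have /perspective_lty := crit_tilde_lty t x fin.
  by move=> /(_ (@hdom t x))[rho srho ->]; exists rho.
pose pi t : 'M[R]_n := \matrix_x (s2val (kernel t x)).
have wE t : w t = \matrix_(x, y) (m (cur_time t) x * pi t x y).
  apply/row_matrixP => x; rewrite (s2valP' (kernel t x)).
  by apply/rowP => y; rewrite !mxE.
exists (m, pi); last by congr (_, _); apply: funext => t; rewrite -wE.
split; first by move=> t x /=; rewrite rowK; exact: s2valP.
apply/kolmogorov_solP; split=> // t x; rewrite mS.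
by apply: eq_bigr => y _; rewrite wE mxE.
Qed.

End flux.

(** * Continuity and compactness *)

Lemma continuous_sum (R : realType) (X : topologicalType) (I : Type)
    (r : seq I) (f : I -> X -> R) :
  (forall i, continuous (f i)) -> continuous (fun x => \sum_(i <- r) f i x).
Proof.
move=> fc x; apply: cvg_big => [ab|i _]; first exact: (cvgD cvg_fst cvg_snd).
exact: fc.
Qed.

Lemma continuous_mx (R : realType) (X : topologicalType) (m n : nat)
    (u : X -> 'M[R]_(m, n)) :
  (forall i j, continuous (fun x => u x i j)) -> continuous u.
Proof.
move=> uc x V [P pP PV].
apply: (@filterS _ (nbhs x) _ (fun y => forall i j, P i j (u y i j))).
  by move=> y Py; apply: PV.
apply: filter_forall => i; apply: filter_forall => j.
exact: (uc i j x _ (pP i j)).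
Qed.

Lemma compact_simplex (R : realType) (n : nat) : compact (simplex R n).
Proof.
have -> : simplex R n =
    [set rho : 'rV[R]_n | forall i, `[0, 1]%classic (rho ord0 i)] `&`
    [set rho : 'rV[R]_n | \sum_(x < n) rho 0 x = 1].
  by apply/seteqP; split=> rho; rewrite /simplex /=.
have cube := @rV_compact R n _ (fun=> @segment_compact R 0 1).
apply: compact_closedI; first exact: cube.
have cont : continuous (fun rho : 'rV[R]_n => \sum_(x < n) rho 0 x).
  by apply: continuous_sum => x; exact: coord_continuous.
by move/continuous_closedP: cont => /(_ [set x | x = 1]);
  apply; exact: closed_eq.
Qed.

Lemma lsc_simplex_lbound (R : realType) (n : nat) (f : 'rV[R]_n -> \bar R) :
  lower_semicontinuous f -> (forall z, f z != -oo%E) ->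
  exists c : R, forall z, simplex R n z -> (c%:E <= f z)%E.
Proof.
move=> lscf fN; have [s0|s0] := pselect (simplex R n !=set0); last first.
  by exists 0 => z sz; case: s0; exists z.
have [|z1 _ z1min] := lsc_compact_min (@compact_simplex R n) s0 (f := f).
  move=> z _; apply: liminf_ge_comp => //; exact: cvg_within.
have [c _ cz1] : exists2 c : R, (-oo < c%:E)%E & (c%:E < f z1)%E.
  by apply: ereal_real_between; rewrite ltNye.
by exists c => z /z1min; apply: le_trans; exact: ltW.
Qed.

Lemma mx_norm_le (R : realType) (m n : nat) (A : 'M[R]_(m, n)) (M : R) :
  0 <= M -> (forall i j, `|A i j| <= M) -> `|A| <= M.
Proof.
move=> M_ge0 AM; rewrite [`|A|]mx_normrE; elim/big_ind: _ => //= x y xM yM.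
by rewrite ge_max xM.
Qed.

(** * Existence of an optimal policy *)

Section existence.
Variables (R : realType) (T n : nat) (m0 : 'rV[R]_n).
Hypothesis sm0 : simplex R n m0.
Variables (alpha : 'I_T -> 'M[R]_n) (ell : 'I_T -> 'I_n -> 'rV[R]_n -> \bar R)
  (phi : 'I_T -> R -> \bar R) (F : 'I_T.+1 -> 'rV[R]_n -> \bar R).
Hypothesis ellN : forall t x z, ell t x z != -oo%E.
Hypothesis lsc_ell : forall t x, lower_semicontinuous (ell t x).
Hypothesis lsc_phi : forall t, lower_semicontinuous (phi t : R^o -> \bar R).
Hypothesis lsc_F : forall s, lower_semicontinuous (F s).

(** Policies indexed by pairs (time, state), so that they carry a product
    topology and form a product of simplices to which Tychonoff applies. *)
Definition kernels := prod_topology (fun _ : 'I_T * 'I_n => 'rV[R]_n).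

Definition policy_of (f : kernels) (t : 'I_T) : 'M[R]_n := \matrix_x f (t, x).

Definition outcome (f : kernels) : pairs R T n :=
  (kolmogorov_sol m0 (policy_of f), policy_of f).

Definition stochastic_kernels : set kernels :=
  [set f | forall i, simplex R n (f i)].

Lemma stochastic_kernels_compact : compact stochastic_kernels.
Proof.
exact: (@tychonoff ('I_T * 'I_n)%type (fun=> 'rV[R]_n)
  (fun=> simplex R n) (fun=> @compact_simplex R n)).
Qed.

Lemma policy_of_continuous t x y : continuous (fun f => policy_of f t x y).
Proof.
move=> f.
have -> : (fun f => policy_of f t x y) =
    (fun rho : 'rV_n => rho 0 y) \o proj (t, x).
  by apply: funext => g; rewrite /= mxE.
apply: continuous_comp; first exact: proj_continuous.
exact: coord_continuous.
Qed.

Lemma flow_continuous k x : continuous (fun f => flow m0 (policy_of f) k 0 x).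
Proof.
elim: k x => [|k IH] x /=; first by move=> f; exact: cst_continuous.
rewrite (_ : (fun f => _) = fun f =>
    \sum_y flow m0 (policy_of f) k 0 y * policy_at (policy_of f) k y x);
  last by apply: funext => f; rewrite mxE.
apply: continuous_sum => y f; apply: continuousM; first exact: IH.
rewrite /policy_at; case: insub => [t|]; first exact: policy_of_continuous.
exact: cst_continuous.
Qed.

Lemma mass_continuous s x : continuous (fun f => (outcome f).1 s x).
Proof.
rewrite (_ : (fun f => _) = fun f => flow m0 (policy_of f) s 0 x).
  exact: flow_continuous.
by apply: funext => f; rewrite mxE.
Qed.

Lemma row_policy_continuous t x : continuous (fun f => row x ((outcome f).2 t)).
Proof.
rewrite (_ : (fun f => _) = proj (t, x)); first exact: proj_continuous.
by apply: funext => f; rewrite rowK.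
Qed.

Lemma row_mass_continuous s : continuous (fun f => row s (outcome f).1).
Proof.
apply: continuous_mx => i x.
rewrite (_ : (fun f => _) = fun f => (outcome f).1 s x).
  exact: mass_continuous.
by apply: funext => f; rewrite mxE.
Qed.

Lemma load_continuous t : continuous (fun f =>
  \sum_x \sum_y
    (outcome f).1 (cur_time t) x * (outcome f).2 t x y * alpha t x y).
Proof.
apply: continuous_sum => x; apply: continuous_sum => y f.
apply: (@continuousM _ _
  (fun g => (outcome g).1 (cur_time t) x * (outcome g).2 t x y)
  (fun=> alpha t x y)); last exact: cst_continuous.
by apply: continuousM; [exact: mass_continuous|exact: policy_of_continuous].
Qed.

Lemma feasP_outcome f : stochastic_kernels f -> feasP m0 (outcome f).
Proof. by move=> sf; split=> // t x; rewrite rowK; exact: sf. Qed.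

Lemma outcome_surj p :
  feasP m0 p -> exists2 f, stochastic_kernels f & outcome f = p.
Proof.
case: p => m pi /= [/= pol ->].
have piE : policy_of (fun i => row i.2 (pi i.1)) = pi.
  by apply: funext => t; apply/row_matrixP => x; rewrite rowK.
exists (fun i => row i.2 (pi i.1)); last by rewrite /outcome piE.
by move=> i; exact: pol.
Qed.

(** The masses of an outcome are polynomial in the policy, hence continuous. The
    restriction to stochastic kernels supplies what [liminf_geM] asks for:
    nonnegative masses, and rows in the simplex, where [ell] is bounded
    below. *)
Lemma crit_liminf f : stochastic_kernels f ->
  liminf_ge (within stochastic_kernels (nbhs f))
    (fun g => crit alpha ell phi F (outcome g))
    (crit alpha ell phi F (outcome f)).
Proof.
move=> sf; set G := within _ _.
have FG : Filter G by exact: within_filter.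
have toG (Y : topologicalType) (u : kernels -> Y) (p : Y) :
    u @ f --> p -> u @ G --> p.
  by move=> up; apply: cvg_trans up; apply: cvg_app; exact: cvg_within.
have mass_ge0 g s x : stochastic_kernels g -> 0 <= (outcome g).1 s x.
  by move=> /feasP_outcome; exact: feasP_mass_ge0.
have stoch : \forall g \near G, stochastic_kernels g by exact: withinT.
rewrite /crit /outcome /=; apply: liminf_geD; first apply: liminf_geD.
- apply: liminf_ge_sum => t; apply: liminf_ge_sum => x.
  have [c cell] := lsc_simplex_lbound (@lsc_ell t x) (ellN t x).
  apply: (@liminf_geM _ _ _ _ _ _ _ _ c).
  + by apply: toG; exact: mass_continuous.
  + exact: mass_ge0 sf.
  + by apply: filterS stoch => g; exact: mass_ge0.
  + by apply: filterS stoch => g sg; apply: cell; rewrite rowK; exact: sg.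
  + apply: (@liminf_ge_comp _ _ _ _ _ (ell t x)) => //.
    by apply: toG; exact: row_policy_continuous.
- apply: liminf_ge_sum => t; apply: (@liminf_ge_comp _ _ _ _ R^o (phi t)) => //.
  by apply: toG; exact: load_continuous.
- apply: liminf_ge_sum => s; apply: (@liminf_ge_comp _ _ _ _ _ (F s)) => //.
  by apply: toG; exact: row_mass_continuous.
Qed.

Lemma crit_min : exists2 p, feasP m0 p &
  forall q, feasP m0 q -> (crit alpha ell phi F p <= crit alpha ell phi F q)%E.
Proof.
have [|f sf fmin] := lsc_compact_min stochastic_kernels_compact _ crit_liminf.
  by exists (fun=> m0) => i; exact: sm0.
exists (outcome f); first exact: feasP_outcome.
by move=> q /outcome_surj[g sg <-]; exact: fmin.
Qed.

End existence.

(** * Boundedness and conclusion *)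

Lemma feasP_bounded (R : realType) (T n : nat) (m0 : 'rV[R]_n)
    (p : pairs R T n) :
  simplex R n m0 -> feasP m0 p ->
  [/\ `|p.1| <= 1, forall t, `|p.2 t| <= 1 & forall t, `|(flux p).2 t| <= 1].
Proof.
move=> sm0 fp.
have mass s x : 0 <= p.1 s x <= 1.
  by have [/(_ x)] := feasP_mass sm0 s fp; rewrite mxE.
have rate t x y : 0 <= p.2 t x y <= 1.
  by have [/(_ y)] := fp.1 t x; rewrite mxE.
split=> [|t|t]; apply: mx_norm_le => // i j; rewrite ?mxE.
- by have /andP[m_ge0 m_le1] := mass i j; rewrite ger0_norm.
- by have /andP[r_ge0 r_le1] := rate t i j; rewrite ger0_norm.
- have /andP[m_ge0 m_le1] := mass (cur_time t) i.
  have /andP[r_ge0 r_le1] := rate t i j.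
  by rewrite ger0_norm ?mulr_ge0// mulr_ile1.
Qed.

Theorem lemma3p3 (R : realType) (T n : nat) (hT : (1 <= T)%N) (hn : (1 <= n)%N)
  (m0 : 'rV[R]_n) (hm0 : simplex R n m0)
  (alpha : 'I_T -> 'M[R]_n)
  (ell : 'I_T -> 'I_n -> 'rV[R]_n -> \bar R)
  (phi : 'I_T -> R -> \bar R)
  (F : 'I_T.+1 -> 'rV[R]_n -> \bar R)
  (hell : forall t x, proper_convex_lsc (ell t x))
  (hF : forall s, proper_convex_lsc (F s))
  (hphi : forall t, proper_convex_lsc (phi t : R^o -> \bar R))
  (hdom : forall t x z, (ell t x z < +oo)%E -> simplex R n z) :
  optval (feasP m0) (crit alpha ell phi F) =
    optval (feasP_tilde m0) (crit_tilde alpha ell phi F) /\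
  ((exists pi, policies R T n pi /\
      (crit alpha ell phi F (kolmogorov_sol m0 pi, pi) < +oo)%E) ->
   [/\ solutions (feasP m0) (crit alpha ell phi F) !=set0,
       bounded_pairs (solutions (feasP m0) (crit alpha ell phi F)),
       solutions (feasP_tilde m0) (crit_tilde alpha ell phi F) !=set0 &
       bounded_pairs (solutions (feasP_tilde m0) (crit_tilde alpha ell phi F))]).
Proof.
have ellN t x z : ell t x z != -oo%E by have [[]] := hell t x.
have phiN t a : phi t a != -oo%E by have [[]] := hphi t.
have FN s z : F s z != -oo%E by have [[]] := hF s.
set J := crit alpha ell phi F; set Jt := crit_tilde alpha ell phi F.
have Jflux p : feasP m0 p -> Jt (flux p) = J p.
  by move=> fp; apply: crit_flux => s x; exact: feasP_mass_ge0 fp.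
have fluxK q : feasP_tilde m0 q -> (Jt q < +oo)%E ->
    exists2 p, feasP m0 p & flux p = q.
  exact: feasP_tilde_lty.
have val_eq : optval (feasP m0) J = optval (feasP_tilde m0) Jt.
  apply/eqP; rewrite eq_le; apply/andP; split.
    apply/ereal_infP => _ [q fq <-].
    have [->|Jq] := eqVneq (Jt q) +oo%E; first exact: leey.
    have [|p fp <-] := fluxK q fq; first by rewrite ltey.
    by rewrite Jflux//; apply: ereal_inf_lbound; exists p.
  apply/ereal_infP => _ [p fp <-]; rewrite -Jflux//.
  by apply: ereal_inf_lbound; exists (flux p) => //; exact: feasP_flux.
split=> // -[pi [pol finite]].
have val_fin : (optval (feasP m0) J < +oo)%E.
  apply: le_lt_trans finite; apply: ereal_inf_lbound.
  by exists (kolmogorov_sol m0 pi, pi).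
have [p fp pmin] : exists2 p, feasP m0 p &
    forall q, feasP m0 q -> (J p <= J q)%E.
  apply: crit_min => // [t x|t|s]; first by have [] := hell t x.
    by have [] := hphi t.
  by have [] := hF s.
have pval : J p = optval (feasP m0) J.
  apply/eqP; rewrite eq_le; apply/andP; split; last first.
    by apply: ereal_inf_lbound; exists p.
  by apply/ereal_infP => _ [q fq <-]; exact: pmin.
split.
- by exists p.
- by exists 1 => q [fq _]; have [] := feasP_bounded hm0 fq.
- by exists (flux p); split; [exact: feasP_flux|rewrite Jflux// pval].
- exists 1 => q [fq qval]; have [|r fr <-] := fluxK q fq.
    by rewrite qval -val_eq.
  by have [] := feasP_bounded hm0 fr.
Qed.
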